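(* Let $\alpha_n(123)$ be the number of permutations $\pi\in\mathfrak{S}_n$ with no index $1\le j\le n-2$ such that $\pi_j<\pi_{j+1}<\pi_{j+2}$. For $k\in\mathbb{Z}$ let $\lambda_k=\frac{\sqrt3}{2\pi(k+\frac13)}$, and for $k\ge1$ let $r_k=|\lambda_{-k}|=\frac{\sqrt3}{2\pi(k-\frac13)}$. Then for every non-negative integer $K$, $$\frac{\alpha_n(123)}{n!}=\sum_{|k|\le K}(-1)^k\exp\!\left(\frac{1}{2\lambda_k}\right)\lambda_k^{\,n+1}+O\big(r_{K+1}^{\,n}\big)\quad\text{as }n\to\infty.$$ *)

(* Defs.v *)
From mathcomp Require Export all_boot all_order all_algebra perm.
From mathcomp Require Export boolp classical_sets functions reals topology normedtype.
From mathcomp Require Export landau sequences trigo exp.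

Set Implicit Arguments.
Unset Strict Implicit.
Unset Printing Implicit Defensive.

Import Order.TTheory GRing.Theory Num.Theory.
Import numFieldNormedType.Exports.

Local Open Scope ring_scope.

(* The one-line notation of s is read on positions and values 0, ..., n - 1;
   the order pattern does not depend on this shift. *)
Definition avoids123 (n : nat) (s : 'S_n) : bool :=
  ~~ [exists i : 'I_n, exists j : 'I_n, exists k : 'I_n,
      [&& j == i.+1 :> nat, k == i.+2 :> nat & (s i < s j < s k)%N]].

Definition alpha123 (n : nat) : nat := #|[set s : 'S_n | avoids123 s]|.

Definition lambda (R : realType) (k : int) : R :=
  Num.sqrt 3 / (2 * pi * (k%:~R + 1 / 3)).

Definition r (R : realType) (k : nat) : R := `|lambda R (- k%:Z)|.

Lemma rE (R : realType) (k : nat) : (1 <= k)%N ->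
  r R k = Num.sqrt 3 / (2 * pi * (k%:R - 1 / 3)).
Proof.
move=> k1; have lt13 : (1 / 3 : R) < 1.
  by rewrite ltr_pdivrMr ?mul1r ?ltr1n ?ltr0n.
have k13 : 0 < k%:R - 1 / 3 :> R.
  by rewrite subr_gt0 (lt_le_trans lt13)// ler1n.
rewrite /r /lambda rmorphN /= -pmulrn.
have -> : - k%:R + 1 / 3 = - (k%:R - 1 / 3) :> R by rewrite opprB addrC.
rewrite mulrN invrN mulrN normrN ger0_norm//.
by rewrite divr_ge0 ?sqrtr_ge0// mulr_ge0 ?(ltW k13)// mulr_ge0 ?ler0n ?pi_ge0.
Qed.

(* The sum of F k over the integers k with |k| <= K, enumerated as k = i - K
   for 0 <= i <= 2K. *)
Definition sum_absz_le (R : realType) (K : nat) (F : int -> R) : R :=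
  \sum_(i < K.*2.+1) F (i%:Z - K%:Z).

(* Main.v *)
Require Import Defs.
From mathcomp Require Import derive.
From mathcomp Require Import zify ring lra.

(** Evaluating [sum_j c_j * [the first j entries increase, the rest avoids 123]],
    with [c] the 3-periodic sequence [1, -1, 0], gives zero at every permutation
    of size [n > 0].  Summing over permutations, the exponential generating
    function of [alpha123] is the inverse of [sum_j c_j x^j / j!], that is
    [(sqrt 3 / 2) e^(x/2) / cos (sqrt 3 x / 2 + pi / 6)].

    The poles of the secant factor are the [1 / lambda k].  No complex analysis
    is needed: the cosine is the coefficientwise limit of the polynomials
    [Re (e^(i pi/6) (1 + i sqrt 3 x / (2 N))^N)], which have the [N] real roots
    [2 N / sqrt 3 * tan (pi (k + 1/3) / N)].  Since [|tan t| >= |t|], the partial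
    fractions of their inverses are dominated by the [|lambda k|^(n+1)]
    uniformly in [N], so one may pass to the limit with an error controlled by
    the first omitted pole.  Convolving with the coefficients of [e^(x/2)]
    multiplies the k-th term by [exp (1 / (2 lambda k))], up to the tail of the
    exponential series, which is negligible. *)

Set Implicit Arguments.
Unset Strict Implicit.
Unset Printing Implicit Defensive.

Import Order.TTheory GRing.Theory Num.Theory.
Import numFieldNormedType.Exports.

Local Open Scope ring_scope.

(** * Counting by ascent words *)

(** The coefficients of [(1 - x) / (1 - x^3) = 1 / (1 + x + x^2)]. *)
Definition coef123 (R : pzRingType) (j : nat) : R :=
  if (j %% 3 == 0)%N then 1 else if (j %% 3 == 1)%N then -1 else 0.

Fixpoint no_double_ascent (w : seq bool) : bool :=
  if w is b :: w' then ~~ (b && head false w') && no_double_ascent w' else true.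

Lemma coef123D3 (R : pzRingType) j : coef123 R j.+3 = coef123 R j.
Proof. by rewrite /coef123 -addn3 modnDr. Qed.

(* Deleting three leading ascents shifts [j] by 3 and changes nothing else. *)
Lemma sum_coef123_word (R : pzRingType) (w : seq bool) :
  \sum_(j < (size w).+2)
    coef123 R j *+ (all id (take j.-1 w) && no_double_ascent (drop j w)) = 0.
Proof.
have [n] := ubnP (size w); elim: n w => // n IH [|b w] /=.
  by rewrite !big_ord_recl big_ord0 /= /coef123 /= ?(mulr0n, mulr1n, mul0rn, addr0, subrr).
(* Words are split by the number of leading ascents: with none or one, the terms [j = 0] and [j = 1]
   cancel; with exactly two, [j = 1] and [j = 3] do. Three or more reduce to the induction
   hypothesis. *)
case: b => [|_] /=; last first.
  rewrite 2!big_ord_recl /= drop0 big1 => [|i _]; last by rewrite mulr0n.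
  by rewrite /coef123 /= ?drop0; case: no_double_ascent; rewrite ?(addr0, mulr0n, mulr1n, subrr).
case: w => [_|b w] /=.
  by rewrite !big_ord_recl big_ord0 /= /coef123 /= ?(mulr0n, mulr1n, mul0rn, addr0, subrr).
case: b => [|_] /=; last first.
  rewrite 3!big_ord_recl /= drop0 big1 => [|i _]; last by rewrite mulr0n.
  by rewrite /coef123 /= ?drop0; case: no_double_ascent;
    rewrite ?(addr0, mulr0n, mulr1n, add0r, mul0rn, subrr).
case: w => [_|b w] /=.
  by rewrite !big_ord_recl big_ord0 /= /coef123 /=
    ?(mulr0n, mulr1n, mul0rn, addr0, add0r, addNr).
case: b => [|_] /=; last first.
  rewrite 5!big_ord_recl /= big1 => [|i _]; last by rewrite mulr0n.
  by rewrite /coef123 /= ?drop0; case: no_double_ascent;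
    rewrite ?(mulr0n, mulr1n, mul0rn, addr0, add0r, addNr).
move=> sw; rewrite 3!big_ord_recl /= mulr0n add0r mulr0n add0r.
rewrite {1}/coef123 mul0rn add0r -[RHS](IH w); last lia.
by apply: eq_bigr => -[[|i] ?] _; rewrite /= /bump /= !add1n coef123D3 ?take0.
Qed.

Definition ascents {T : Type} (e : rel T) (s : seq T) : seq bool :=
  if s is x :: s' then pairmap e x s' else [::].

Definition avoids {T : Type} (e : rel T) (s : seq T) : bool :=
  no_double_ascent (ascents e s).

Lemma size_ascents {T : Type} (e : rel T) s : size (ascents e s) = (size s).-1.
Proof. by case: s => //= x s; rewrite size_pairmap. Qed.

Lemma all_ascents {T : Type} (e : rel T) s : all id (ascents e s) = sorted e s.
Proof. by case: s => //= x s; elim: s x => //= y s IH x; rewrite IH. Qed.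

Lemma ascents_take {T : Type} (e : rel T) j s :
  ascents e (take j s) = take j.-1 (ascents e s).
Proof.
case: s j => [|x s] [|j] //=; first by rewrite take0.
by elim: s j x => [|y s IH] [|j] x //=; rewrite IH.
Qed.

Lemma ascents_drop {T : Type} (e : rel T) j s :
  ascents e (drop j s) = drop j (ascents e s).
Proof.
elim: s j => [|x s IH] [|j] //=; rewrite ?drop0 // IH.
by case: s {IH} j => [|y s] [|j] //=; rewrite drop0.
Qed.

(** Cutting [s] after [j > 0] entries forgets the letter of the ascent word that straddles the cut,
    whence the pair [take j.-1], [drop j] in [sum_coef123_word]. *)
Lemma sum_coef123_avoids {T : Type} (e : rel T) (R : pzRingType) (s : seq T) :
  (0 < size s)%N ->
  \sum_(j < (size s).+1)
    coef123 R j *+ (sorted e (take j s) && avoids e (drop j s)) = 0.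
Proof.
move=> s0; rewrite -[RHS](sum_coef123_word R (ascents e s)) size_ascents.
rewrite prednK //; apply: eq_bigr => i _.
by rewrite -all_ascents ascents_take /avoids ascents_drop.
Qed.

Lemma nth_ascents {T : Type} (x0 : T) (e : rel T) s i : (i.+1 < size s)%N ->
  nth false (ascents e s) i = e (nth x0 s i) (nth x0 s i.+1).
Proof. by case: s => //= x s is_; rewrite (nth_pairmap x0). Qed.

Lemma map_ascents {S T : Type} (e : rel T) (e' : rel S) (f : S -> T) s :
  {mono f : x y / e' x y >-> e x y} -> ascents e (map f s) = ascents e' s.
Proof.
by move=> fe; case: s => //= x s; elim: s x => //= y s IH x; rewrite IH fe.
Qed.

Lemma perm_permutations_map {S T : eqType} (f : S -> T) (s : seq S) :
  injective f -> uniq s ->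
  perm_eq (map (map f) (permutations s)) (permutations (map f s)).
Proof.
move=> f_inj us; have ufs : uniq (map f s) by rewrite map_inj_uniq.
have ump : uniq (map (map f) (permutations s)).
  by rewrite map_inj_uniq ?permutations_uniq //; apply: inj_map.
apply: uniq_perm => //; first exact: permutations_uniq.
apply: (uniq_min_size ump _ _).2; last first.
  by rewrite size_map !size_permutations // size_map.
by move=> u /mapP[v]; rewrite !mem_permutations => vs ->; apply: perm_map.
Qed.

Lemma no_double_ascentP (w : seq bool) :
  reflect (forall i, ~~ (nth false w i && nth false w i.+1)) (no_double_ascent w).
Proof.
apply: (iffP idP).
  by elim: w => [|b w IH] /= => [_ [|i] //|/andP[h /IH{}IH] [|i] /=]; rewrite ?nth0 // IH.
elim: w => //= b w IH h; apply/andP; split; first by have := h 0; rewrite /= nth0.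
by apply: IH => i; apply: (h i.+1).
Qed.

(** * From words to permutations: the recurrence for [alpha123] *)

Definition lt_ord {n : nat} : rel 'I_n := fun i j => (i < j)%N.

Lemma avoids123E (n : nat) (s : 'S_n) :
  avoids123 s = avoids lt_ord [seq s i | i <- enum 'I_n].
Proof.
set t := map _ _; have st : size t = n by rewrite size_map size_enum_ord.
have nth_t (i j : 'I_n) : j = i.+1 :> nat ->
    nth false (ascents lt_ord t) i = lt_ord (s i) (s j).
  move=> ji; have nt (k : 'I_n) : nth (s i) t k = s k.
    by rewrite (nth_map i) ?size_enum_ord ?nth_ord_enum.
  by rewrite -(nt i) -(nt j) ji (nth_ascents (s i)) // st -ji.
apply/idP/no_double_ascentP => [/existsPn h i|h].
  (* Past the end of the ascent word [nth] returns [false], so such positions impose nothing. *)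
  have [ltin|lein] := ltnP i.+2 n; last first.
    by rewrite [X in _ && X]nth_default ?andbF // size_ascents st; lia.
  have ltin1 : (i.+1 < n)%N by lia.
  have ltin0 : (i < n)%N by lia.
  have /existsPn/(_ (Ordinal ltin1))/existsPn/(_ (Ordinal ltin)) := h (Ordinal ltin0).
  by rewrite /= !eqxx /= (nth_t (Ordinal ltin0) (Ordinal ltin1)) //
    (nth_t (Ordinal ltin1) (Ordinal ltin)).
apply/existsPn => i; apply/existsPn => j; apply/existsPn => k.
apply/negP => /and3P[/eqP ji /eqP ki sijk].
have := h i; rewrite (nth_t i j) // -ji (nth_t j k) ?ki ?ji //.
by rewrite /lt_ord sijk.
Qed.

(** One-line notation is injective and there are [n!] elements on both sides, so the one-line
    notations exhaust the rearrangements of [enum 'I_n]. *)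
Lemma alpha123E (n : nat) :
  alpha123 n = count (avoids lt_ord) (permutations (enum 'I_n)).
Proof.
pose f (s : 'S_n) := [seq s i | i <- enum 'I_n].
have f_inj : injective f.
  move=> s t /eq_in_map st; apply/permP => i; apply: st.
  by rewrite mem_enum.
have uf : uniq (map f (enum {: 'S_n})) by rewrite map_inj_uniq ?enum_uniq.
have /seq.permP <- : perm_eq (map f (enum {: 'S_n})) (permutations (enum 'I_n)).
  apply: uniq_perm => //; first exact: permutations_uniq.
  apply: (uniq_min_size uf _ _).2; last first.
    have -> : size (permutations (enum 'I_n)) = n`!.
      by rewrite size_permutations ?enum_uniq ?size_enum_ord.
    rewrite size_map -cardE.
    by rewrite -card_Sn; apply: subset_leq_card; apply/fintype.subsetP.
  move=> _ /mapP[s _ ->]; rewrite mem_permutations; apply: uniq_perm.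
  - by rewrite map_inj_uniq ?enum_uniq //; apply: perm_inj.
  - exact: enum_uniq.
  move=> i; rewrite mem_enum inE; apply/mapP; exists ((s^-1)%g i).
    by rewrite mem_enum.
  by rewrite permKV.
rewrite count_map /alpha123 cardE -size_filter; apply/esym/perm_size.
apply: uniq_perm => [||s]; last 1 first.
- by rewrite mem_filter !mem_enum !inE andbT -avoids123E.
- by apply: filter_uniq; exact: enum_uniq.
- exact: enum_uniq.
Qed.

Lemma lt_ord_trans (n : nat) : transitive (@lt_ord n).
Proof. by move=> ? ? ?; apply: ltn_trans. Qed.

(** Avoidance depends only on relative order, so entries may be relabelled along the increasing map
    [tnth (in_tuple s)]. *)
Lemma count_avoids_sorted (n : nat) (s : seq 'I_n) : sorted lt_ord s ->
  count (avoids lt_ord) (permutations s) = alpha123 (size s).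
Proof.
move=> ss; rewrite alpha123E.
have homo (i j : 'I_(size s)) :
    (i < j)%N -> lt_ord (tnth (in_tuple s) i) (tnth (in_tuple s) j).
  move=> ij; pose x0 := tnth (in_tuple s) i; rewrite !(tnth_nth x0).
  exact: (sorted_ltn_nth (@lt_ord_trans n) x0 ss _ _ (ltn_ord i) (ltn_ord j) ij).
have mono : {mono tnth (in_tuple s) : i j / lt_ord i j >-> lt_ord i j}.
  move=> i j; have [ij|ji|ij] := ltngtP i j.
  - by rewrite homo // /lt_ord ij.
  - have := homo _ _ ji; rewrite /lt_ord => h.
    by rewrite [in RHS]ltnNge (ltnW ji) ltnNge (ltnW h).
  - by rewrite (val_inj ij) /lt_ord !ltnn.
have inj : injective (tnth (in_tuple s)).
  move=> i j tij; apply/val_inj; have := mono i j; have := mono j i.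
  by rewrite tij /lt_ord ltnn; case: ltngtP.
have /seq.permP := perm_permutations_map inj (enum_uniq 'I_(size s)).
rewrite map_tnth_enum => <-; rewrite count_map; apply: eq_count => t.
by rewrite /= /avoids (map_ascents _ mono).
Qed.

Lemma sorted_enum_ord (n : nat) (B : {set 'I_n}) : sorted lt_ord (enum B).
Proof.
rewrite {1}/enum_mem; apply: sorted_filter; first exact: lt_ord_trans.
rewrite -enumT -(@sorted_map _ _ val ltn) val_enum_ord; exact: iota_ltn_sorted.
Qed.

(** An increasing prefix is determined by its set of values [B]; what remains is an avoiding
    arrangement of the complement of [B]. The list [L] enumerates these pairs. *)
Lemma count_increasing_avoids (n j : nat) : (j <= n)%N ->
  count (fun t => sorted lt_ord (take j t) && avoids lt_ord (drop j t))
    (permutations (enum 'I_n)) = ('C(n, j) * alpha123 (n - j))%N.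
Proof.
move=> jn.
pose D := enum [set B : {set 'I_n} | #|B| == j].
pose U (B : {set 'I_n}) :=
  [seq u <- permutations (enum (~: B)) | avoids lt_ord u].
have inD (B : {set 'I_n}) : (B \in D) = (#|B| == j) by rewrite mem_enum inE.
have sizeB (B : {set 'I_n}) : B \in D -> size (enum B) = j.
  by rewrite inD -cardE => /eqP.
pose L := [seq enum (B : {set _}) ++ u | B <- D, u <- U B].
have uL : uniq L.
  apply: allpairs_uniq_dep => [|B _|]; first exact: enum_uniq.
    by apply: filter_uniq; apply: permutations_uniq.
  move=> _ _ /allpairsPdep[B [u [BD _ ->]]] /allpairsPdep[B' [u' [BD' _ ->]]] /=.
  move=> /eqP; rewrite eqseq_cat ?sizeB // => /andP[/eqP eB /eqP ->].
  by have -> : B = B' by apply/setP => x; rewrite -mem_enum eB mem_enum.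
rewrite -size_filter; transitivity (size L).
  apply/perm_size/uniq_perm => // [|t].
    by apply: filter_uniq; apply: permutations_uniq.
  rewrite mem_filter mem_permutations; apply/idP/allpairsPdep => [|[B [u []]]].
    case/andP => /andP[st at_] pt.
    have ut : uniq t by rewrite (perm_uniq pt) enum_uniq.
    have tt x : x \in t by rewrite (perm_mem pt) mem_enum.
    have szt : size (take j t) = j.
      by rewrite size_takel // (perm_size pt) size_enum_ord.
    pose B := [set x in take j t].
    have eB : enum B = take j t.
      apply: (irr_sorted_eq (@lt_ord_trans n)) => //.
      - by move=> x; rewrite /lt_ord ltnn.
      - exact: sorted_enum_ord.
      by move=> x; rewrite mem_enum inE.
    exists B, (drop j t); split; last by rewrite eB cat_take_drop.
      by rewrite inD cardE eB szt.
    rewrite mem_filter at_ mem_permutations; apply: uniq_perm.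
    - exact: drop_uniq.
    - exact: enum_uniq.
    move=> x; rewrite mem_enum !inE; move: ut (tt x).
    rewrite -{1 2}[t](cat_take_drop j) cat_uniq mem_cat => /and3P[_ /hasPn h _].
    by case: (boolP (x \in drop j t)) => [/h/negbTE -> //|_]; rewrite orbF => ->.
  move=> BD; rewrite mem_filter mem_permutations => /andP[au pu] ->.
  rewrite -{1 2}(sizeB _ BD) take_size_cat // drop_size_cat // sorted_enum_ord au.
  rewrite (permPl (perm_cat (perm_refl _) pu)); apply: uniq_perm.
  - rewrite cat_uniq !enum_uniq andbT; apply/hasPn => x.
    by rewrite !mem_enum inE.
  - exact: enum_uniq.
  by move=> x; rewrite mem_cat !mem_enum inE orbN.
rewrite size_allpairs_dep sumnE big_map.
rewrite (eq_big_seq (fun=> alpha123 (n - j))) => [|B BD]; last first.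
  rewrite size_filter count_avoids_sorted ?sorted_enum_ord // -cardE.
  by rewrite cardsCs card_ord finset.setCK cardE sizeB.
rewrite big_const_seq count_predT iter_addn_0 mulnC -cardE; congr (_ * _)%N.
by rewrite -[X in 'C(X, _)]card_ord -card_draws; apply: eq_card => B; rewrite !inE.
Qed.

(** The cancellation at each single permutation is summed over all of them and the two sums are
    exchanged. *)
Lemma alpha123_recurrence (R : pzRingType) (n : nat) : (0 < n)%N ->
  \sum_(j < n.+1) coef123 R j *+ ('C(n, j) * alpha123 (n - j)) = 0.
Proof.
move=> n0.
transitivity (\sum_(t <- permutations (enum 'I_n)) \sum_(j < n.+1)
    coef123 R j *+ (sorted lt_ord (take j t) && avoids lt_ord (drop j t))).
  rewrite exchange_big /=; apply: eq_bigr => -[j jn] _ /=.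
  by rewrite -count_increasing_avoids // -sum1_count sumrMnr big_mkcond.
rewrite big_seq big1 // => t; rewrite mem_permutations => /perm_size.
rewrite size_enum_ord => st; rewrite -[RHS](@sum_coef123_avoids _ (@lt_ord n) R t) ?st //.
Qed.

Lemma alpha123_0 : alpha123 0 = 1%N.
Proof.
have e0 : enum 'I_0 = [::] by apply: size0nil; rewrite size_enum_ord.
by rewrite alpha123E e0.
Qed.

(** * Exponential generating functions *)

Definition conv {R : pzSemiRingType} (f g : nat -> R) (n : nat) : R :=
  \sum_(j < n.+1) f j * g (n - j)%N.

Definition delta0 {R : pzSemiRingType} (n : nat) : R := (n == 0%N)%:R.

Definition egf {R : unitRingType} (f : nat -> R) (n : nat) : R := f n / n`!%:R.

Lemma convE {R : comNzRingType} (f g : nat -> R) (n m : nat) : (n <= m)%N ->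
  conv f g n = ((\poly_(i < m.+1) f i) * (\poly_(i < m.+1) g i))`_n.
Proof.
move=> nm; rewrite coefM; apply: eq_bigr => -[j jn] _ /=.
by rewrite !coef_poly !ifT //; lia.
Qed.

Lemma convC {R : comNzRingType} (f g : nat -> R) : conv f g = conv g f.
Proof. by apply/funext => n; rewrite !(convE _ _ (leqnn n)) mulrC. Qed.

Lemma convA {R : comNzRingType} (f g h : nat -> R) :
  conv f (conv g h) = conv (conv f g) h.
Proof.
apply/funext => n.
pose P (k : nat -> R) := \poly_(i < n.+1) k i.
have PE k j : (j < n.+1)%N -> (P k)`_j = k j by move=> jn; rewrite coef_poly jn.
transitivity ((P f * (P g * P h))`_n).
  rewrite coefM; apply: eq_bigr => -[j jn] _ /=.
  by rewrite PE // (@convE _ g h _ n) ?leq_subr.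
rewrite mulrA coefM; apply: eq_bigr => -[j jn] _ /=.
by rewrite PE 1?ltnS ?leq_subr // (@convE _ f g _ n).
Qed.

Lemma conv1f {R : comNzRingType} (f : nat -> R) : conv delta0 f = f.
Proof.
apply/funext => n; rewrite /conv big_ord_recl big1 => [|i _].
  by rewrite subn0 mul1r addr0.
by rewrite /delta0 mul0r.
Qed.

(** On exponential generating functions in [t], this is multiplication by [e^(x t)]. *)
Definition binomial_transform {R : pzSemiRingType} (x : R) (f : nat -> R) (n : nat) : R :=
  \sum_(j < n.+1) (f j * x ^+ (n - j)) *+ 'C(n, j).

Lemma binomial_transform0 {R : pzSemiRingType} (x : R) f :
  binomial_transform x f 0 = f 0%N.
Proof. by rewrite /binomial_transform big_ord1 mulr1. Qed.

(** Pascal's rule; on generating functions, the product rule for the derivative of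
    [e^(x t) F(t)]. *)
Lemma binomial_transformS {R : comNzRingType} (x : R) f n :
  binomial_transform x f n.+1 =
  x * binomial_transform x f n + binomial_transform x (fun j => f j.+1) n.
Proof.
rewrite /binomial_transform big_ord_recl /=.
under eq_bigr => i _ do rewrite /bump /= add1n binS mulrnDr subSS.
rewrite big_split /= addrA; congr (_ + _).
rewrite mulr_sumr [RHS]big_ord_recl /= !bin0 !mulr1n !subn0 exprS mulrCA; congr (_ + _).
rewrite big_ord_recr /= bin_small // mulr0n addr0; apply: eq_bigr => -[i ni] _ /=.
by rewrite /bump /= add1n mulrnAr mulrCA -exprS subnSK.
Qed.

Lemma conv_egf {R : realFieldType} (f g : nat -> R) n :
  conv (egf f) (egf g) n = (\sum_(j < n.+1) (f j * g (n - j)%N) *+ 'C(n, j)) / n`!%:R.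
Proof.
rewrite mulr_suml; apply: eq_bigr => -[j jn] _ /=; rewrite /egf.
have nz k : k`!%:R != 0 :> R by rewrite pnatr_eq0 -lt0n fact_gt0.
rewrite -(bin_fact (n := n) (m := j)) // -mulr_natr !natrM.
have c0 : 'C(n, j)%:R != 0 :> R by rewrite pnatr_eq0 -lt0n bin_gt0.
by field; rewrite !nz c0.
Qed.

Lemma conv_exp_coeffN {R : realType} (x : R) :
  conv (exp_coeff (- x)) (exp_coeff x) = delta0.
Proof.
apply/funext => n; transitivity (conv (egf (GRing.exp (- x))) (egf (GRing.exp x)) n) => //.
rewrite conv_egf; transitivity ((x - x) ^+ n / n`!%:R).
  rewrite exprDn; congr (_ / _); apply: eq_bigr => j _.
  by rewrite [x ^+ _ * _]mulrC.
by rewrite subrr expr0n /delta0; case: n => [|n] /=; rewrite ?divr1 ?mul0r.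
Qed.

(* [n! [x^n]] of [2 / sqrt 3 * cos (sqrt 3 / 2 * x + pi / 6)]. *)
Definition cos_seq (R : unitRingType) (n : nat) : R :=
  (- (3 / 4)) ^+ n./2 * (if odd n then - 2^-1 else 1).

Lemma cos_seqSS {R : unitRingType} n : cos_seq R n.+2 = - (3 / 4) * cos_seq R n.
Proof. by rewrite /cos_seq /= negbK exprS mulrA. Qed.

(** The recursion [cSS] says [F'' = - F - F'] for the generating function [F] of [coef123]. The
    factor [e^(t/2)] removes the first-order term and leaves [y'' = - (3/4) y], the recursion of
    [cos_seq]. The shifted transform [V] stands for [e^(t/2) F']. *)
Lemma binomial_transform_coef123 {R : realFieldType} n :
  binomial_transform 2^-1 (coef123 R) n = cos_seq R n.
Proof.
pose U := binomial_transform 2^-1 (coef123 R) .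
pose V := binomial_transform 2^-1 (fun j => coef123 R j.+1).
have cSS j : coef123 R j.+2 = - coef123 R j - coef123 R j.+1.
  rewrite /coef123 -[j.+2]addn2 -[j.+1]addn1 -(modnDml j) -(modnDml j 1).
  by have := ltn_pmod j (isT : 0 < 3)%N; case: (j %% 3)%N => [|[|[|//]]] _ /=; ring.
have VS m : V m.+1 = 2^-1 * V m - U m - V m.
  rewrite /V binomial_transformS -addrA; congr (_ + _).
  rewrite /U /binomial_transform -opprD -big_split -sumrN; apply: eq_bigr => j _.
  by rewrite /= cSS -mulrnDl -mulNrn; congr (_ *+ _); ring.
suff : U n = cos_seq R n /\ V n = cos_seq R n.+1 - 2^-1 * cos_seq R n by case.
elim: n => [|n [IHU IHV]].
  by rewrite /U /V !binomial_transform0 /cos_seq /coef123 /=; split; field.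
rewrite VS /U binomial_transformS -/(U n) -/(V n) IHU IHV cos_seqSS.
by split; field.
Qed.

Section reciprocals.
Variable R : realType.

Definition alpha_seq : nat -> R := egf (fun n => (alpha123 n)%:R).

(** The coefficients of [(sqrt 3 / 2) / cos (sqrt 3 x / 2 + pi / 6)], by [conv_cos_sec]. *)
Definition sec_seq : nat -> R := conv (exp_coeff (- 2^-1)) alpha_seq.

Lemma conv_coef123_alpha : conv (egf (coef123 R)) alpha_seq = delta0.
Proof.
apply/funext => -[|n]; rewrite conv_egf.
  by rewrite big_ord1 alpha123_0 /coef123 /delta0 /= mulr1 divr1.
rewrite /delta0 /= -[RHS](mul0r (n.+1`!%:R^-1)); congr (_ / _).
rewrite -[RHS](@alpha123_recurrence R n.+1) //; apply: eq_bigr => j _.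
by rewrite mulr_natr -mulrnA mulnC.
Qed.

Lemma alpha_seqE : alpha_seq = conv (exp_coeff 2^-1) sec_seq.
Proof. by rewrite /sec_seq convA (convC (exp_coeff _)) conv_exp_coeffN conv1f. Qed.

Lemma conv_cos_sec : conv (egf (cos_seq R)) sec_seq = delta0.
Proof.
have -> : egf (cos_seq R) = conv (egf (coef123 R)) (exp_coeff 2^-1).
  apply/funext => n; rewrite -[exp_coeff _]/(egf (GRing.exp 2^-1)) conv_egf.
  by rewrite /egf -binomial_transform_coef123.
rewrite /sec_seq -convA [X in conv _ X]convA [X in conv _ (conv X _)]convC.
by rewrite conv_exp_coeffN conv1f conv_coef123_alpha.
Qed.

End reciprocals.

(** The power series of [1 / P = sum_i 1 / (P'(x_i) (X - x_i))], each simple fraction being expanded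
    as a geometric series. The identity itself is Lagrange interpolation of the constant 1 at the
    roots. *)
Lemma conv_partial_fractions {F : fieldType} (P : {poly F}) (N : nat) (x : 'I_N -> F) :
  (0 < N)%N -> (size P <= N.+1)%N -> injective x -> (forall i, x i != 0) ->
  (forall i, root P (x i)) -> (forall i, P^`().[x i] != 0) ->
  conv (fun j => P`_j) (fun n => \sum_i - (P^`().[x i])^-1 * (x i)^-1 ^+ n.+1) = delta0.
Proof.
move=> N0 sP x_inj x0 Px P'x.
(* The cofactor [P / (1 - X / x_i)], scaled so that its coefficients ([Ln]) are those of [P]
   convolved with the powers of [1 / x_i]. *)
pose L i := - x i *: (P %/ ('X - (x i)%:P)).
have LE i : P = L i * (1 - (x i)^-1 *: 'X).
  rewrite -{1}(divpK (_ : 'X - (x i)%:P %| P)) ?dvdp_XsubCl //.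
  rewrite /L -scalerAl scalerAr scalerBr scalerA mulNr mulfV // scaleN1r opprK.
  by rewrite scaleNr alg_polyC addrC.
have sL i : (size (L i) <= N)%N.
  apply: leq_trans (size_scale_leq _ _) _.
  by rewrite size_divp ?polyXsubC_eq0 // size_XsubC leq_subLR addnC addn1.
clearbody L.
have Lk i k : k != i -> (L i).[x k] = 0.
  move=> ki; have /eqP := Px k; rewrite [in P.[_]](LE i) !hornerE => /eqP.
  rewrite mulf_eq0 => /orP[/eqP //|]; rewrite subr_eq0 eq_sym => /eqP e.
  by case/eqP: ki; apply: x_inj; rewrite -[x k]mul1r -(mulfV (x0 i)) -mulrA e mulr1.
have Li i : (L i).[x i] = - x i * P^`().[x i].
  rewrite [in P^`()](LE i) derivM !poly.derivE !hornerE.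
  by field.
have Ln i n : (L i)`_n = \sum_(j < n.+1) P`_j * (x i)^-1 ^+ (n - j).
  elim: n => [|n IH].
    by rewrite big_ord1 mulr1 [in RHS](LE i) coef0M !coefE /= mulr0 subr0 mulr1.
  rewrite big_ord_recr /= subnn mulr1.
  under eq_bigr => j _ do rewrite subSn -1?ltnS ?ltn_ord // exprSr mulrA.
  rewrite -mulr_suml -IH [in P`_ _](LE i) mulrBr mulr1 coefB -scalerAr [X in _ - X]coefZ coefMX.
  by rewrite /= mulrC addrC subrK.
pose S := \sum_i - (P^`().[x i])^-1 * (x i)^-1 *: L i.
(* Both sides have degree less than [N] and agree at the [N] roots of [P]. *)
have S1 : S = 1.
  apply/eqP; rewrite -subr_eq0; apply/eqP.
  apply: (@roots_geq_poly_eq0 _ _ [seq x i | i <- enum 'I_N]).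
  - apply/allP => _ /mapP[k _ ->]; apply/rootP; rewrite hornerD hornerN hornerC.
    rewrite horner_sum (bigD1 k) //= big1 => [|i ik]; last first.
      by rewrite hornerZ Lk 1?eq_sym // mulr0.
    by rewrite hornerZ Li; field; rewrite P'x x0.
  - by rewrite map_inj_uniq ?enum_uniq.
  rewrite size_map size_enum_ord; apply: leq_trans (size_polyD _ _) _.
  rewrite size_polyN size_poly1 geq_max N0 andbT; apply: leq_trans (size_sum _ _ _) _.
  by apply/bigmax_leqP => i _; apply: leq_trans (size_scale_leq _ _) _.
apply/funext => n; transitivity (S`_n); last by rewrite S1 coef1.
rewrite coef_sum /conv; under eq_bigr => j _ do rewrite mulr_sumr.
rewrite exchange_big /=; apply: eq_bigr => i _; rewrite coefZ Ln mulr_sumr.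
apply: eq_bigr => j _; rewrite exprS -!mulrA; rewrite mulrCA; congr (_ * _).
by rewrite mulrCA.
Qed.

(** * Polynomial approximations of the cosine *)

Section cosine_polynomials.
Variable R : realType.
Implicit Types (phi theta : R) (k : int).

(** The real part of [e^(i phi) (1 + i tan theta)^m cos^m theta = e^(i (phi + m theta))]; the power
    [i^j] appears as a phase shift by [j] quarter turns. *)
Lemma cos_tan_binomial phi theta m : cos theta != 0 ->
  binomial_transform 1 (fun j => cos (phi + j%:R * (pi / 2)) * tan theta ^+ j) m
    * cos theta ^+ m = cos (phi + m%:R * theta).
Proof.
move=> c0; elim: m phi => [|m IH] phi.
  by rewrite binomial_transform0 !mul0r addr0 !mulr1.
rewrite binomial_transformS mul1r.
have -> : binomial_transform 1
    (fun j => cos (phi + j.+1%:R * (pi / 2)) * tan theta ^+ j.+1) m =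
  tan theta * binomial_transform 1
    (fun j => cos ((phi + pi / 2) + j%:R * (pi / 2)) * tan theta ^+ j) m.
  rewrite /binomial_transform mulr_sumr; apply: eq_bigr => j _.
  rewrite mulrnAr; congr (_ *+ _); rewrite exprS !expr1n !mulr1 mulrCA.
  by congr (_ * (cos _ * _)); rewrite -[j.+1]add1n natrD; ring.
have := IH phi; have := IH (phi + pi / 2).
move: (binomial_transform _ _ _) (binomial_transform _ _ _) => B A hA hB.
transitivity (cos theta * (B * cos theta ^+ m) + cos theta * tan theta * (A * cos theta ^+ m)).
  by rewrite exprS; ring.
rewrite hA hB /tan [cos theta * (_ / _)]mulrC divfK // addrAC cosDpihalf.
have -> : phi + m.+1%:R * theta = (phi + m%:R * theta) + theta.
  by rewrite -[m.+1]addn1 natrD; ring.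
by rewrite [RHS]cosD; ring.
Qed.

(** Tripling the angle gives [4 c^3 - 3 c = cos (pi / 2) = 0] with [c > 0]. *)
Lemma cos_pi6 : cos (pi / 6) = Num.sqrt 3 / 2 :> R.
Proof.
have pi0 := pi_gt0 R.
have c0 : 0 < cos (pi / 6) :> R by rewrite cos_gt0_pihalf //; apply/andP; split; lra.
have : cos (pi / 6 *+ 2 + pi / 6) = 0 :> R.
  by rewrite -[RHS](@cos_pihalf R); congr cos; rewrite -mulr_natl; field.
rewrite cosD cos_mulr2n sin_mulr2n => h.
have s2 := cos2Dsin2 (pi / 6 : R).
have {}h : cos (pi / 6) * (cos (pi / 6) ^+ 2 - 3 / 4) = 0 :> R.
  move: h s2; move: (cos _) (sin _) => c s h s2.
  transitivity (((c ^+ 2 *+ 2 - 1) * c - (c * s) *+ 2 * s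
    + c * 2 * (c ^+ 2 + s ^+ 2 - 1)) / 4); first by field.
  by rewrite h s2 subrr mulr0 addr0 mul0r.
move/eqP: h; rewrite mulf_eq0 gt_eqF //= subr_eq0 => /eqP h.
have : cos (pi / 6) ^+ 2 == (Num.sqrt 3 / 2) ^+ 2 :> R.
  by rewrite h exprMn sqr_sqrtr ?ler0n //; apply/eqP; field.
by rewrite eqrXn2 ?divr_ge0 ?sqrtr_ge0 ?ler0n // ?ltW // => /eqP.
Qed.

Lemma sin_pi6 : sin (pi / 6) = 2^-1 :> R.
Proof.
have pi0 := pi_gt0 R.
have s0 : 0 <= sin (pi / 6) :> R by rewrite sin_ge0_pi //; apply/andP; split; lra.
have : sin (pi / 6) ^+ 2 == 2^-1 ^+ 2 :> R.
  by rewrite sin2cos2 cos_pi6 exprMn sqr_sqrtr ?ler0n //; apply/eqP; field.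
by rewrite eqrXn2 ?invr_ge0 ?ler0n // => /eqP.
Qed.

(** Raising [j] by two changes the sign of both sides, so two consecutive indices are carried
    through the induction. *)
Lemma cos_seqE j : cos_seq R j * (2 / Num.sqrt 3) ^+ j =
  2 / Num.sqrt 3 * cos (pi / 6 + j%:R * (pi / 2)).
Proof.
have s30 : Num.sqrt 3 != 0 :> R by rewrite sqrtr_eq0 -ltNge ltr0n.
have s3 : Num.sqrt 3 ^+ 2 = 3 :> R by rewrite sqr_sqrtr ?ler0n.
suff : cos_seq R j * (2 / Num.sqrt 3) ^+ j =
         2 / Num.sqrt 3 * cos (pi / 6 + j%:R * (pi / 2)) /\
       cos_seq R j.+1 * (2 / Num.sqrt 3) ^+ j.+1 =
         2 / Num.sqrt 3 * cos (pi / 6 + j.+1%:R * (pi / 2)) by case.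
elim: j => [|j [IH IH1]].
  rewrite !mul0r !mul1r !addr0 cosDpihalf cos_pi6 sin_pi6 /cos_seq /=.
  by split; field.
split=> //.
have -> : pi / 6 + j.+2%:R * (pi / 2) = pi / 6 + j%:R * (pi / 2) + pi :> R.
  by rewrite -[j.+2]addn2 natrD; field.
rewrite cos_seqSS !exprS cosDpi mulrN -IH.
have q2 : (2 / Num.sqrt 3) ^+ 2 = 4 / 3 :> R by rewrite expr_div_n s3; field.
move: (2 / Num.sqrt 3) q2 => q q2.
transitivity (- (3 / 4) * q ^+ 2 * (cos_seq R j * q ^+ j)); first by ring.
by rewrite q2; field.
Qed.

(* [2 / sqrt 3 * Re (e^(i pi/6) (1 + i sqrt 3 X / (2 N))^N)]. *)
Definition cos_poly (N : nat) : {poly R} :=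
  \poly_(j < N.+1) (cos_seq R j * N%:R^-1 ^+ j *+ 'C(N, j)).

Lemma size_cos_poly N : (size (cos_poly N) <= N.+1)%N.
Proof. exact: size_poly. Qed.

Lemma coef_cos_poly N j : (cos_poly N)`_j = cos_seq R j * N%:R^-1 ^+ j *+ 'C(N, j).
Proof.
by rewrite coef_poly; case: ltnP => // Nj; rewrite bin_small ?mulr0n.
Qed.

(** The argument is chosen so that [1 + i sqrt 3 x / (2 N)] becomes [1 + i tan theta]. *)
Lemma cos_poly_tan N theta : (0 < N)%N -> cos theta != 0 ->
  (cos_poly N).[N%:R * (2 / Num.sqrt 3 * tan theta)] =
  2 / Num.sqrt 3 * cos (pi / 6 + N%:R * theta) / cos theta ^+ N.
Proof.
move=> N0 c0; have NR : N%:R != 0 :> R by rewrite pnatr_eq0 -lt0n.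
rewrite -cos_tan_binomial // -[RHS]mulrA mulfK ?expf_neq0 //.
rewrite (horner_coef_wide _ (size_cos_poly N)) mulr_sumr; apply: eq_bigr => j _.
rewrite coef_cos_poly mulrnAr -[X in X * _ = _]mulr_natr -[RHS]mulr_natr expr1n mulr1.
rewrite [_ * (cos _ * _)]mulrA -cos_seqE; set q := 2 / _.
transitivity (cos_seq R j * q ^+ j * tan theta ^+ j * (N%:R^-1 ^+ j * N%:R ^+ j)
  * 'C(N, j)%:R); first by rewrite !exprMn; ring.
by rewrite -exprMn mulVf // expr1n; ring.
Qed.

(** Differentiation lowers the power by one and brings out [i sqrt 3 / 2]: the [i] advances the
    phase by [pi / 2], and the modulus cancels the prefactor [2 / sqrt 3]. *)
Lemma deriv_cos_poly_tan N theta : cos theta != 0 ->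
  (cos_poly N.+1)^`().[N.+1%:R * (2 / Num.sqrt 3 * tan theta)] =
  cos (pi / 6 + pi / 2 + N%:R * theta) / cos theta ^+ N.
Proof.
move=> c0; have NR : N.+1%:R != 0 :> R by rewrite pnatr_eq0.
have s30 : Num.sqrt 3 != 0 :> R by rewrite sqrtr_eq0 -ltNge ltr0n.
rewrite -cos_tan_binomial // mulfK ?expf_neq0 //.
have sD : (size (cos_poly N.+1)^`() <= N.+1)%N.
  by apply/leq_sizeP => j Nj; rewrite coef_deriv coef_cos_poly bin_small ?mul0rn.
rewrite (horner_coef_wide _ sD); apply: eq_bigr => j _.
rewrite coef_deriv coef_cos_poly -mulrnA mulnC -mul_bin_diag /=.
rewrite -[X in X * _ = _]mulr_natr -[RHS]mulr_natr natrM expr1n mulr1.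
have -> : pi / 6 + pi / 2 + j%:R * (pi / 2) = pi / 6 + j.+1%:R * (pi / 2) :> R.
  by rewrite -[j.+1]add1n natrD; ring.
apply: (mulfI (_ : 2 / Num.sqrt 3 != 0)); first by rewrite mulf_neq0 ?invr_neq0 ?pnatr_eq0.
rewrite [RHS]mulrA [_ * (cos _ * _)]mulrA -cos_seqE !exprS; set q := 2 / _.
transitivity (cos_seq R j.+1 * (q * q ^+ j) * tan theta ^+ j * 'C(N, j)%:R *
   ((N.+1%:R^-1 * N.+1%:R) * (N.+1%:R^-1 ^+ j * N.+1%:R ^+ j))).
  by rewrite !exprMn; ring.
by rewrite -exprMn mulVf // expr1n !mulr1.
Qed.

Lemma cosDzpi (x : R) k : cos (x + k%:~R * pi) = (-1) ^ k * cos x.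
Proof.

have H := alternatingn (@cosDpi R).
case: k => n; first by rewrite -[_ ^ _]/((-1) ^+ n) -H -[pi *+ n]mulr_natl.
have := H n.+1 (x + (Negz n)%:~R * pi).
rewrite -[pi *+ n.+1]mulr_natl NegzE mulrNz mulNr subrK => ->.
by rewrite mulrA -[_ ^ _]/((-1) ^- n.+1) mulVf ?mul1r // expf_neq0 // oppr_eq0 oner_eq0.
Qed.

(** Mean value theorem: the derivative [1 + tan^2] is at least 1. *)
Lemma tan_ge_id theta : 0 <= theta < pi / 2 -> theta <= tan theta.
Proof.
case/andP; rewrite le_eqVlt => /predU1P[<- _|t0 tpi]; first by rewrite tan0.
have cx x : x \in `[0, theta] -> cos x != 0.
  rewrite in_itv /= => /andP[x0 xt]; rewrite gt_eqF // cos_gt0_pihalf //.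
  by have := pi_gt0 R; move=> ?; apply/andP; split; lra.
have [||c ct] := @MVT R tan (fun x => (cos x) ^- 2) _ _ t0.
- by move=> x xt; apply: is_derive_tan; apply: cx; apply: subset_itv_oo_cc.
- by apply: derivable_within_continuous => x xt; apply: derivable_tan; apply: cx.
have cc : cos c != 0 by apply: cx; apply: subset_itv_oo_cc.
by rewrite tan0 !subr0 => ->; rewrite ler_peMl ?(ltW t0) // cos2_tan2 // lerDl sqr_ge0.
Qed.

Lemma norm_tan_ge_id theta : `|theta| < pi / 2 -> `|theta| <= `|tan theta|.
Proof.
move=> h; have := @tan_ge_id `|theta|; rewrite normr_ge0 h => /(_ isT).
move=> /le_trans; apply; case: (ger0P theta) => _; first exact: ler_norm.
by rewrite tanN -normrN ler_norm.
Qed.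

End cosine_polynomials.

(** Pairing [k] with [-k] lets the range [|k| <= M] be split at [K]. *)
Lemma sum_absz_leE (R : realType) (K : nat) (F : int -> R) :
  sum_absz_le K F = F 0 + \sum_(1 <= k < K.+1) (F k%:Z + F (- k%:Z)).
Proof.
rewrite /sum_absz_le; elim: K => [|K IH].
  by rewrite big_ord1 big_geq // !addr0.
rewrite doubleS big_ord_recr big_ord_recl /= [in RHS]big_nat_recr //= addrA -IH.
transitivity (F (- K.+1%:Z) + \sum_(i < K.*2.+1) F (i%:Z - K%:Z) + F K.+1%:Z).
  by congr (F _ + _ + F _); [lia | apply: eq_bigr => i _; congr F; rewrite /bump /=; lia | lia].
by rewrite -addrA addrCA [X in _ + X]addrC.
Qed.

(** * Roots of the approximating polynomials and the partial fractions of their inverses *)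

Section secant_nodes.
Variable R : realType.
Implicit Types (k : int) (M : nat).

(** The solution of [pi / 6 + N theta = pi / 2 + k pi] for [N = 2 M + 1]. With [N] odd, the indices
    [|k| <= M] give exactly [N] angles, all in the open interval from [- pi / 2] to [pi / 2]. *)
Definition node_angle M k : R := pi * (k%:~R + 1 / 3) / M.*2.+1%:R.

Definition node M k : R :=
  M.*2.+1%:R * (2 / Num.sqrt 3 * tan (node_angle M k)).

Definition sec_approx M (n : nat) : R := sum_absz_le M (fun k =>
  (-1) ^ k * cos (node_angle M k) ^+ M.*2.-1 * (node M k)^-1 ^+ n.+1).

Lemma third_neq0 k : k%:~R + 1 / 3 != 0 :> R.
Proof.
have -> : k%:~R + 1 / 3 = (3 * k + 1)%:~R / 3 :> R.
  by rewrite rmorphD rmorphM /=; field.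
by rewrite mulf_neq0 ?invr_neq0 ?intr_eq0 ?pnatr_eq0 //; lia.
Qed.

Lemma norm_node_angle M k : (`|k| <= M)%N -> `|node_angle M k| < pi / 2.
Proof.
move=> kM; have pi0 := pi_gt0 R; have N0 : 0 < M.*2.+1%:R :> R by rewrite ltr0n.
rewrite ltr_norml /node_angle ltr_pdivrMr // ltr_pdivlMr //.
have h1 : k%:~R <= M%:R :> R by rewrite -[M%:R]/(M%:~R) ler_int; lia.
have h2 : - M%:R <= k%:~R :> R by rewrite -[M%:R]/(M%:~R) -rmorphN ler_int; lia.
have -> : M.*2.+1%:R = 2 * M%:R + 1 :> R by rewrite -addn1 natrD -mul2n natrM.
have l1 : (pi : R) * (- (M%:R + 2^-1)) < pi * (k%:~R + 1 / 3) by rewrite ltr_pM2l //; lra.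
have l2 : (pi : R) * (k%:~R + 1 / 3) < pi * (M%:R + 2^-1) by rewrite ltr_pM2l //; lra.
apply/andP; split.
  by apply: le_lt_trans l1; rewrite le_eqVlt; apply/orP; left; apply/eqP; field.
by apply: lt_le_trans l2 _; rewrite le_eqVlt; apply/orP; left; apply/eqP; field.
Qed.

Lemma cos_node_gt0 M k : (`|k| <= M)%N -> 0 < cos (node_angle M k).
Proof. by move=> /norm_node_angle; rewrite ltr_norml; apply: cos_gt0_pihalf. Qed.

Lemma node_angle_inj M : injective (node_angle M).
Proof.
move=> k l /(divIf _)/=; rewrite pnatr_eq0 => /(_ isT).
by move=> /(mulfI (lt0r_neq0 (pi_gt0 R)))/addIr/intr_inj.
Qed.

Lemma lambdaV k : (lambda R k)^-1 = 2 / Num.sqrt 3 * (pi * (k%:~R + 1 / 3)).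
Proof. by rewrite /lambda invf_div -[2 * pi * _]mulrA mulrAC. Qed.

Lemma lambda_neq0 k : lambda R k != 0.
Proof.
rewrite -invr_eq0 lambdaV !mulf_eq0 invr_eq0 pnatr_eq0 sqrtr_eq0 leNgt ltr0n.
by rewrite (negbTE (third_neq0 k)) (gt_eqF (pi_gt0 R)).
Qed.

(** Replacing the tangent in [node M k] by its argument gives exactly [1 / lambda k]. *)
Lemma nodeV_norm_le M k : (`|k| <= M)%N -> `|(lambda R k)^-1| <= `|node M k|.
Proof.
move=> kM; have N0 : M.*2.+1%:R != 0 :> R by rewrite pnatr_eq0.
have -> : (lambda R k)^-1 = M.*2.+1%:R * (2 / Num.sqrt 3 * node_angle M k).
  by rewrite lambdaV /node_angle [RHS]mulrCA; congr (_ * _); rewrite [RHS]mulrC divfK.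
have := norm_tan_ge_id (norm_node_angle kM); rewrite /node.
move: (tan (node_angle M k)) => t; move: (node_angle M k) (2 / _) => a q h; rewrite !normrM.
by do 2 (apply: ler_wpM2l; first exact: normr_ge0).
Qed.

Lemma node_neq0 M k : (`|k| <= M)%N -> node M k != 0.
Proof.
move=> /nodeV_norm_le h; rewrite -normr_gt0 (lt_le_trans _ h) //.
by rewrite normr_gt0 invr_neq0 // lambda_neq0.
Qed.

Lemma norm_nodeV_le M k : (`|k| <= M)%N -> `|(node M k)^-1| <= `|lambda R k|.
Proof.
move=> kM; rewrite -[X in _ <= `|X|]invrK normfV [X in _ <= X]normfV.
rewrite lef_pV2 ?posrE ?normr_gt0 ?invr_neq0 ?lambda_neq0 ?node_neq0 //.
exact: nodeV_norm_le.
Qed.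

Lemma node_angleE M k : M.*2.+1%:R * node_angle M k = pi / 3 + k%:~R * pi.
Proof. by rewrite /node_angle mulrC divfK ?pnatr_eq0 //; field. Qed.

Lemma root_node M k : (`|k| <= M)%N -> root (cos_poly R M.*2.+1) (node M k).
Proof.
move=> kM; apply/rootP; rewrite /node cos_poly_tan ?gt_eqF ?cos_node_gt0 //.
rewrite node_angleE addrA (_ : pi / 6 + pi / 3 = pi / 2); last by field.
by rewrite cosDzpi cos_pihalf !mulr0 mul0r.
Qed.

(** At a node the phase of the derivative is [pi - theta + k pi], so its cosine cancels one of the
    [2 M] factors [cos theta]; the exponent [M.*2.-1] is then a true subtraction because [0 < M]. *)
Lemma deriv_node M k : (0 < M)%N -> (`|k| <= M)%N ->
  - ((cos_poly R M.*2.+1)^`().[node M k])^-1 =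
  (-1) ^ k * cos (node_angle M k) ^+ M.*2.-1.
Proof.
move=> M0 kM; have c0 := cos_node_gt0 kM.
rewrite /node deriv_cos_poly_tan ?gt_eqF //.
have -> : pi / 6 + pi / 2 + M.*2%:R * node_angle M k =
    (- node_angle M k + pi) + k%:~R * pi.
  have e := node_angleE M k; rewrite -[M.*2.+1]addn1 natrD mulrDl mul1r in e.
  have -> : M.*2%:R * node_angle M k = pi / 3 + k%:~R * pi - node_angle M k.
    by rewrite -e addrK.
  by field.
rewrite cosDzpi cosDpi cosN mulrN mulNr invrN opprK invf_div invfM mulrCA.
have -> : ((-1 : R) ^ k)^-1 = (-1) ^ k by rewrite invr_expz -exprz_inv invrN invr1.
congr (_ * _); rewrite -[M.*2]prednK ?double_gt0 // exprS mulrC.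
by rewrite mulKf ?gt_eqF.
Qed.

Lemma node_inj M k l : (`|k| <= M)%N -> (`|l| <= M)%N -> node M k = node M l -> k = l.
Proof.
move=> kM lM; rewrite /node => /(mulfI (_ : _ != 0)); rewrite pnatr_eq0 => /(_ isT).
have q0 : 2 / Num.sqrt 3 != 0 :> R.
  by rewrite mulf_eq0 invr_eq0 pnatr_eq0 sqrtr_eq0 leNgt ltr0n.
move=> /(mulfI q0)/tan_inj e; apply: (@node_angle_inj M); apply: e.
  by rewrite in_itv /= -ltr_norml norm_node_angle.
by rewrite in_itv /= -ltr_norml norm_node_angle.
Qed.

Lemma conv_sec_approx M : (0 < M)%N ->
  conv (fun j => (cos_poly R M.*2.+1)`_j) (sec_approx M) = delta0.
Proof.
move=> M0; pose k (i : 'I_M.*2.+1) : int := i%:Z - M%:Z.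
have kM i : (`|k i| <= M)%N by rewrite /k; case: i => i /= ?; lia.
rewrite -(@conv_partial_fractions _ (cos_poly R M.*2.+1) M.*2.+1 (node M \o k)) //.
- congr conv; apply/funext => n; apply: eq_bigr => i _.
  by rewrite /= deriv_node.
- exact: size_cos_poly.
- move=> i j /(node_inj (kM i) (kM j)); rewrite /k => e; apply/val_inj => /=; lia.
- by move=> i; apply: node_neq0.
- by move=> i; apply: root_node.
move=> i; rewrite -invr_eq0 -oppr_eq0 /= deriv_node //.
apply: mulf_neq0; last by rewrite expf_neq0 // gt_eqF // cos_node_gt0.
by apply: expfz_neq0; rewrite oppr_eq0 oner_eq0.
Qed.

End secant_nodes.

(** * Passage to the limit *)

Local Open Scope classical_set_scope.

Section limits.
Variable R : realType.
Implicit Types (k : int) (M n : nat).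

Lemma cvg_sumr (I : Type) (s : seq I) (f : I -> nat -> R) (l : I -> R) :
  (forall i, f i M @[M --> \oo] --> l i) ->
  (\sum_(i <- s) f i M) @[M --> \oo] --> \sum_(i <- s) l i.
Proof.
move=> fl; elim: s => [|i s IH].
  by under eq_fun do rewrite big_nil; rewrite big_nil; apply: cvg_cst.
by under eq_fun do rewrite big_cons; rewrite big_cons; apply: cvgD.
Qed.

Lemma cvg_expr n (f : nat -> R) (l : R) :
  f M @[M --> \oo] --> l -> (f M ^+ n) @[M --> \oo] --> l ^+ n.
Proof.
move=> fl; elim: n => [|n IH]; first exact: cvg_cst.
by under eq_fun do rewrite exprS; rewrite exprS; apply: cvgM.
Qed.

Lemma cvg_double : M.*2 @[M --> \oo] --> \oo.
Proof. by apply/cvgnyPge => A; exists A => //= m /= Am; lia. Qed.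

Lemma cvg_invSn : (n.+1%:R^-1 : R) @[n --> \oo] --> (0 : R).
Proof. exact: cvg_harmonic. Qed.

(** With [N = n + 1], passing from [j] to [j + 1] multiplies the left side by
    [(1 - j / N) / (j + 1)]. *)
Lemma cvg_bin j : ('C(n.+1, j)%:R * n.+1%:R^-1 ^+ j : R) @[n --> \oo] --> (j`!%:R^-1 : R).
Proof.
elim: j => [|j IH].
  by under eq_fun do rewrite bin0 mulr1; rewrite invr1; apply: cvg_cst.
have step : (1 - j%:R * n.+1%:R^-1 : R) @[n --> \oo] --> (1 : R).
  rewrite -[X in _ --> X](_ : 1 - j%:R * 0 = 1); last by rewrite mulr0 subr0.
  apply: cvgB; first exact: cvg_cst.
  by apply: cvgM; [exact: cvg_cst | exact: cvg_invSn].
have lim : (j.+1%:R^-1 * ((1 - j%:R * n.+1%:R^-1) * ('C(n.+1, j)%:R * n.+1%:R^-1 ^+ j)) : R)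
    @[n --> \oo] --> (j.+1%:R^-1 * (1 * j`!%:R^-1) : R).
  by apply: cvgM; [exact: cvg_cst | apply: cvgM].
have -> : j.+1`!%:R^-1 = j.+1%:R^-1 * (1 * j`!%:R^-1) :> R.
  by rewrite factS natrM invfM mul1r.
apply: cvg_trans lim.
apply: near_eq_cvg; exists j => // n /= jn.
have n0 : n.+1%:R != 0 :> R by rewrite pnatr_eq0.
have j0 : j.+1%:R != 0 :> R by rewrite pnatr_eq0.
have /(congr1 (fun m => m%:R : R)) := mul_bin_left n.+1 j.
rewrite !natrM natrB ?(leq_trans jn) // => e.
apply: (mulfI j0); rewrite mulVKf // [RHS]mulrA e exprS.
by move: (n.+1%:R) n0 => N N0; field.
Qed.

Lemma cvg_cos_poly j :
  (cos_poly R M.*2.+1)`_j @[M --> \oo] --> egf (cos_seq R) j.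
Proof.
have lim : (cos_seq R j * ('C(M.*2.+1, j)%:R * M.*2.+1%:R^-1 ^+ j))
    @[M --> \oo] --> (cos_seq R j * j`!%:R^-1).
  apply: cvgM; first exact: cvg_cst.
  have := cvg_comp double (fun n => 'C(n.+1, j)%:R * n.+1%:R^-1 ^+ j : R)
    cvg_double (@cvg_bin j).
  exact.
apply: cvg_trans lim; apply: near_eq_cvg; near=> M.
by rewrite coef_cos_poly -[RHS]mulr_natr -[RHS]mulrA; congr (_ * _); rewrite mulrC.
Unshelve. all: by end_near. Qed.

(** Each coefficient of an inverse series is a polynomial in finitely many coefficients of the
    series, so coefficientwise limits pass to inverses. *)
Lemma cvg_conv_inverse (d s : nat -> R) (D S : nat -> nat -> R) :
  (forall M, D M 0%N = 1) -> d 0%N = 1 ->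
  (\forall M \near \oo, conv (D M) (S M) = delta0) -> conv d s = delta0 ->
  (forall j, D M j @[M --> \oo] --> d j) ->
  forall n, S M n @[M --> \oo] --> s n.
Proof.
move=> D0 d0 DS ds Dd n.
have unfold (f g : nat -> R) m : f 0%N = 1 -> conv f g = delta0 ->
    g m = delta0 m - \sum_(j < m) f j.+1 * g (m - j.+1)%N.
  by move=> f0 <-; rewrite /conv big_ord_recl f0 mul1r subn0 addrK.
elim/ltn_ind: n => n IH; rewrite (unfold d s n d0 ds).
have lim : (delta0 n - \sum_(j < n) D M j.+1 * S M (n - j.+1)%N) @[M --> \oo] -->
    (delta0 n - \sum_(j < n) d j.+1 * s (n - j.+1)%N).
  apply: cvgB; first exact: cvg_cst.
  apply: cvg_sumr => j; apply: cvgM; first exact: Dd.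
  by apply: IH; have := ltn_ord j; lia.
apply: cvg_trans lim; apply: near_eq_cvg; apply: filterS DS => M DS.
by rewrite -unfold.
Qed.

Lemma cvg_sec_approx n : sec_approx R M n @[M --> \oo] --> sec_seq R n.
Proof.
apply: (cvg_conv_inverse (d := egf (cos_seq R)) (D := fun M j => (cos_poly R M.*2.+1)`_j)).
- by move=> M; rewrite coef_cos_poly /cos_seq /= !mulr1.
- by rewrite /egf /cos_seq fact0 invr1 /= ?expr0 !mulr1.
- by exists 1%N => // M /= M0; apply: conv_sec_approx.
- exact: conv_cos_sec.
exact: cvg_cos_poly.
Qed.

End limits.

(** * Limits of the nodes, and a tail bound uniform in the degree *)

Section node_limits.
Variable R : realType.
Implicit Types (k : int) (M n : nat).

(** The derivative of the tangent at 0 is 1; [a != 0] keeps the increments [a / n.+1] in the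
    punctured neighbourhood. *)
Lemma cvg_scaled_tan (a : R) : a != 0 ->
  (n.+1%:R * tan (a / n.+1%:R)) @[n --> \oo] --> a.
Proof.
move=> a0; pose h n : R := a / n.+1%:R.
have h0 n : h n != 0 by rewrite mulf_eq0 negb_or a0 invr_eq0 pnatr_eq0.
have hcvg : h n @[n --> \oo] --> 0^'.
  have hc : h n @[n --> \oo] --> (0 : R).
    rewrite -[X in _ --> X](mulr0 a); apply: cvgM; first exact: cvg_cst.
    exact: cvg_invSn.
  move=> A nA; have hA : \forall n \near \oo, (h n != 0 -> A (h n)) := hc _ nA.
  by apply: filterS hA => n; apply.
have c0 : cos (0 : R) != 0 by rewrite cos0 oner_eq0.
have d := is_derive_tan c0.
have dcvg : (t^-1 *: ((tan \o shift (0 : R)) (t *: (1 : R)) - tan 0)) @[t --> 0^'] --> (1 : R).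
  have := @ex_derive _ _ _ _ _ _ _ d; rewrite /derivable => dc.
  have e := @derive_val _ _ _ _ _ _ _ d; rewrite /derive cos0 expr1n invr1 in e.
  rewrite -[X in _ --> X]e.
  exact: dc.
have lim : (a * ((h n)^-1 *: ((tan \o shift (0 : R)) (h n *: (1 : R)) - tan 0)))
    @[n --> \oo] --> a * 1.
  apply: cvgM; first exact: cvg_cst.
  exact: (cvg_comp h _ hcvg dcvg).
rewrite mulr1 in lim; apply: cvg_trans lim; apply: near_eq_cvg; near=> n.
rewrite /= tan0 subr0 addr0 /h -[_ *: 1]/(_ * 1) mulr1 -[_ *: _]/(_ * _).
by rewrite invf_div mulrA [a * _]mulrC divfK.
Unshelve. all: by end_near. Qed.

(** A Bernoulli-type bound with [1 - c ^+ 2], which for a cosine is a squared sine and hence at most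
    a squared tangent. *)
Lemma exprn_ge_subsqr m (c : R) : 0 <= c <= 1 -> 1 - m%:R * (1 - c ^+ 2) <= c ^+ m.
Proof.
case/andP=> c0 c1; elim: m => [|m IH]; first by rewrite mul0r subr0.
rewrite [c ^+ m.+1]exprS; apply: (@le_trans _ _ (c * (1 - m%:R * (1 - c ^+ 2)))).
  have m0 : 0 <= m%:R :> R by rewrite ler0n.
  have h1 : 0 <= c * (1 - c) by rewrite mulr_ge0 // subr_ge0.
  have h2 : 0 <= m%:R * ((1 - c) * (1 - c ^+ 2)).
    by rewrite !mulr_ge0 // subr_ge0 // exprn_ile1.
  rewrite -[m.+1]addn1 natrD -subr_ge0; apply: le_trans (addr_ge0 h1 h2) _.
  by rewrite le_eqVlt; apply/orP; left; apply/eqP; ring.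
exact: ler_wpM2l.
Qed.

Lemma cvg_node k : node R M k @[M --> \oo] --> (lambda R k)^-1.
Proof.
have a0 : pi * (k%:~R + 1 / 3) != 0 :> R.
  by rewrite mulf_eq0 (negbTE (third_neq0 R k)) gt_eqF ?pi_gt0.
have lim := cvg_comp double (fun n => n.+1%:R * tan (pi * (k%:~R + 1 / 3) / n.+1%:R) : R)
  cvg_double (cvg_scaled_tan a0).
have {}lim : (2 / Num.sqrt 3 * ((M.*2).+1%:R * tan (node_angle R M k)))
    @[M --> \oo] --> (2 / Num.sqrt 3 * (pi * (k%:~R + 1 / 3)) : R).
  by apply: cvgM; [exact: cvg_cst | exact: lim].
rewrite lambdaV; apply: cvg_trans lim; apply: near_eq_cvg; near=> M.
by rewrite /node mulrCA.
Unshelve. all: by end_near. Qed.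

Lemma cvg_cos_node k : (cos (node_angle R M k) ^+ M.*2.-1) @[M --> \oo] --> (1 : R).
Proof.
pose q : R := Num.sqrt 3 / 2.
(* This is [N tan^2 theta] with [N = 2 M + 1], written through the convergent [node] to show that it
   tends to 0. *)
pose t M : R := (q * node R M k) ^+ 2 * (M.*2.+1%:R)^-1.
have t0 : (1 - t M) @[M --> \oo] --> (1 : R).
  have : (1 - t M) @[M --> \oo] --> (1 - (q * (lambda R k)^-1) ^+ 2 * 0).
    apply: cvgB; first exact: cvg_cst.
    have inv0 : (M.*2.+1%:R^-1 : R) @[M --> \oo] --> (0 : R).
      by have := cvg_comp double (fun n => n.+1%:R^-1 : R) cvg_double (@cvg_invSn R); exact.
    apply: cvgM; last exact: inv0.
    by apply: cvg_expr; apply: cvgM; [exact: cvg_cst | exact: cvg_node].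
  by rewrite mulr0 subr0.
apply: (squeeze_cvgr _ t0 (cvg_cst (1 : R))); exists `|k|%N => // M /= kM.
have c0 := cos_node_gt0 R kM; have c1 := cos_le1 (node_angle R M k).
have c01 : 0 <= cos (node_angle R M k) <= 1 by rewrite ltW.
apply/andP; split; last by rewrite exprn_ile1 ?(ltW c0).
apply: le_trans (exprn_ge_subsqr _ c01).
rewrite lerD2l lerN2 -sin2cos2.
have s30 : Num.sqrt 3 != 0 :> R by rewrite sqrtr_eq0 leNgt ltr0n.
have N0 : M.*2.+1%:R != 0 :> R by rewrite pnatr_eq0.
have -> : t M = M.*2.+1%:R * tan (node_angle R M k) ^+ 2.
  rewrite /t /q /node; move: (M.*2.+1%:R) N0 (Num.sqrt 3) s30 (tan _) => N N0 s s30 u.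
  by field; rewrite s30 N0.
apply: ler_pM; rewrite ?ler0n ?sqr_ge0 ?ler_nat //; first by lia.
rewrite /tan expr_div_n ler_pdivlMr ?exprn_gt0 // ler_piMr ?sqr_ge0 //.
by rewrite exprn_ile1 // ltW.
Qed.

Definition sec_term M k n : R :=
  (-1) ^ k * cos (node_angle R M k) ^+ M.*2.-1 * (node R M k)^-1 ^+ n.+1.

Lemma cvg_sec_term k n :
  sec_term M k n @[M --> \oo] --> ((-1) ^ k * lambda R k ^+ n.+1 : R).
Proof.
rewrite -[X in X * _]mulr1; apply: cvgM.
  by apply: cvgM; [exact: cvg_cst | exact: cvg_cos_node].
apply: cvg_expr; rewrite -[X in _ --> X]invrK; apply: cvgV; last exact: cvg_node.
by rewrite invr_eq0 lambda_neq0.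
Qed.

Lemma norm_exprN1z k : `|(-1 : R) ^ k| = 1.
Proof.
case: k => n.
  by rewrite -[_ ^ _]/((-1) ^+ n) normrX normrN1 expr1n.
by rewrite -[_ ^ _]/((-1) ^- n.+1) normfV normrX normrN1 expr1n invr1.
Qed.

(** The bound does not involve [M]: this is the domination that allows the passage to the limit. *)
Lemma norm_sec_term_le M k n : (`|k| <= M)%N -> `|sec_term M k n| <= `|lambda R k| ^+ n.+1.
Proof.
move=> kM; rewrite /sec_term normrM normrM norm_exprN1z mul1r.
rewrite !normrX -[X in _ <= X]mul1r; apply: ler_pM; rewrite ?exprn_ge0 ?normr_ge0 //.
  by rewrite exprn_ile1 ?normr_ge0 // cos_max.
by apply: lerXn2r; rewrite ?nnegrE ?normr_ge0 // norm_nodeV_le.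
Qed.

Lemma r_gt0 (k : nat) : 0 < r R k.
Proof. by rewrite /r normr_gt0 lambda_neq0. Qed.

Lemma sqrt3_gt0 : 0 < Num.sqrt 3 :> R.
Proof. by rewrite sqrtr_gt0 ltr0n. Qed.

Lemma natr_ge1 (k : nat) : (1 <= k)%N -> 1 <= k%:R :> R.
Proof. by rewrite ler1n. Qed.

Lemma r_nonincreasing (k l : nat) : (1 <= k)%N -> (k <= l)%N -> r R l <= r R k.
Proof.
move=> k1 kl; have k1R := natr_ge1 k1; have klR : k%:R <= l%:R :> R by rewrite ler_nat.
have pi0 := pi_gt0 R; rewrite !rE ?(leq_trans k1) //.
rewrite ler_pM2l ?sqrt3_gt0 // lef_pV2 ?posrE ?mulr_gt0 //; try lra.
by rewrite ler_pM2l ?mulr_gt0 //; lra.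
Qed.

Lemma norm_lambda_le_r (k : nat) : (1 <= k)%N -> `|lambda R k%:Z| <= r R k.
Proof.
move=> k1; have k1R := natr_ge1 k1; have pi0 := pi_gt0 R.
rewrite rE // /lambda -pmulrn ger0_norm; last first.
  by rewrite divr_ge0 ?sqrtr_ge0 // mulr_ge0 ?mulr_ge0 //; lra.
rewrite ler_pM2l ?sqrt3_gt0 // lef_pV2 ?posrE ?mulr_gt0 //; nra.
Qed.

(** Crude, from [sqrt 3 <= 2 <= pi], but enough to compare tails with the sum of [1 / k^2]. *)
Lemma r_le_inv (k : nat) : (1 <= k)%N -> r R k <= k%:R^-1.
Proof.
move=> k1; have k1R := natr_ge1 k1; have pi2 := pi_ge2 R.
have s3 : Num.sqrt 3 <= 2 :> R.
  have -> : 2 = Num.sqrt (2 ^+ 2) :> R by rewrite sqrtr_sqr ger0_norm.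
  by apply: ler_wsqrtr; lra.
rewrite rE // ler_pdivrMr; last by rewrite !mulr_gt0 //; lra.
apply: le_trans s3 _; rewrite mulrC ler_pdivlMr; last lra.
have : 2 * (2 * (k%:R - 1 / 3)) <= 2 * pi * (k%:R - 1 / 3) :> R.
  by rewrite -mulrA ler_pM2l // ler_wpM2r //; lra.
by move=> h; apply: le_trans h; lra.
Qed.

Lemma sum_inv_sqr_le (m n : nat) : (1 <= m)%N -> \sum_(m <= k < n) (k%:R^-1) ^+ 2 <= 2 :> R.
Proof.
move=> m1; have [mn|nm] := leqP m n; last by rewrite big_geq // ltnW.
have pos (a b : nat) : 0 <= \sum_(a <= k < b) (k%:R^-1) ^+ 2 :> R.
  by apply: sumr_ge0 => i _; rewrite sqr_ge0.
apply: (@le_trans _ _ (\sum_(1 <= k < n) (k%:R^-1) ^+ 2)).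
  by rewrite [X in _ <= X](big_cat_nat _ mn) //= lerDr.
apply: (@le_trans _ _ (\sum_(1 <= k < n.+2) (k%:R^-1) ^+ 2)).
  by rewrite [X in _ <= X](big_cat_nat _ (_ : (n <= n.+2)%N)) ?lerDl //; lia.
(* The strengthened bound telescopes; the range up to [n.+2] makes the base case the single term
   [k = 1]. *)
suff : \sum_(1 <= k < n.+2) (k%:R^-1) ^+ 2 <= 2 - n.+1%:R^-1 :> R.
  by move/le_trans; apply; rewrite gerBl invr_ge0.
elim: n {mn} => [|n IH]; first by rewrite big_nat1 !invr1; lra.
rewrite big_nat_recr //=; apply: le_trans (lerD IH (lexx _)) _.
rewrite -[n.+2]addn1 natrD; move: (n.+1%:R) (ler0n R n.+1) (pnatr_eq0 R n.+1) => x x0 /= xn0.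
have {}x0 : 0 < x by rewrite lt_neqAle x0 eq_sym xn0.
rewrite -addrA lerD2l -subr_ge0.
have -> : - (x + 1)^-1 - (- x^-1 + (x + 1)^-1 ^+ 2) = (x * (x + 1) ^+ 2)^-1.
  by field; apply/andP; split; apply: lt0r_neq0 => //; lra.
by rewrite invr_ge0 mulr_ge0 ?sqr_ge0 // ltW.
Qed.

(** At index [n.+1] the power is [n.+2]: [n] factors are bounded by [r R K.+1], the other two by
    [1 / k] for summability. The 4 is 2 terms per pair [k], [-k] times the bound 2 on the sum of
    inverse squares. *)
Lemma sec_approx_tail K M n : (K <= M)%N ->
  `|sec_approx R M n.+1 - sum_absz_le K (fun k => sec_term M k n.+1)| <= 4 * r R K.+1 ^+ n.
Proof.
move=> KM; rewrite /sec_approx !sum_absz_leE (@big_cat_nat _ _ _ K.+1 1 M.+1) //=.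
rewrite opprD addrACA subrr add0r addrC addKr.
have bound (k : nat) (l : int) : (K.+1 <= k < M.+1)%N -> `|l|%N = k ->
    `|lambda R l| <= r R k -> `|sec_term M l n.+1| <= r R K.+1 ^+ n * (k%:R^-1) ^+ 2.
  case/andP=> Kk kM lk ll; apply: le_trans (norm_sec_term_le _ _) _; first by rewrite lk.
  have k1 : (1 <= k)%N by apply: leq_trans Kk.
  rewrite -addn2 exprD; apply: ler_pM; rewrite ?exprn_ge0 ?normr_ge0 //.
    apply: lerXn2r; rewrite ?nnegrE ?normr_ge0 ?(ltW (r_gt0 _)) //.
    by apply: le_trans ll _; apply: r_nonincreasing.
  apply: lerXn2r; rewrite ?nnegrE ?normr_ge0 ?invr_ge0 //.
  by apply: le_trans ll _; apply: r_le_inv.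
apply: le_trans (ler_norm_sum _ _ _) _.
apply: (@le_trans _ _ (\sum_(K.+1 <= k < M.+1) 2 * r R K.+1 ^+ n * (k%:R^-1) ^+ 2)).
  apply: ler_sum_nat => k kKM; apply: le_trans (ler_normD _ _) _.
  have k1 : (1 <= k)%N by case/andP: kKM => Kk _; apply: leq_trans Kk.
  have -> : 2 * r R K.+1 ^+ n * (k%:R^-1) ^+ 2 =
    r R K.+1 ^+ n * (k%:R^-1) ^+ 2 + r R K.+1 ^+ n * (k%:R^-1) ^+ 2 by ring.
  apply: lerD; apply: bound => //; first exact: norm_lambda_le_r.
  by rewrite abszN.
rewrite -mulr_sumr (_ : 4 * _ = 2 * r R K.+1 ^+ n * 2); last by ring.
apply: ler_wpM2l; last exact: sum_inv_sqr_le.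
by rewrite mulr_ge0 // exprn_ge0 // ltW // r_gt0.
Qed.

Lemma sec_seq_expansion K : exists2 C : R, 0 <= C & forall n,
  `|sec_seq R n - sum_absz_le K (fun k => (-1) ^ k * lambda R k ^+ n.+1)| <= C * r R K.+1 ^+ n.
Proof.
pose A (n : nat) : R := `|sec_seq R n - sum_absz_le K (fun k => (-1) ^ k * lambda R k ^+ n.+1)|.
have AS n : A n.+1 <= 4 * r R K.+1 ^+ n.
  have lim : `|sec_approx R M n.+1 - sum_absz_le K (fun k => sec_term M k n.+1)|
      @[M --> \oo] --> A n.+1.
    apply: cvg_norm; apply: cvgB; first exact: cvg_sec_approx.
    by apply: cvg_sumr => i; apply: cvg_sec_term.
  apply: (ler_cvg_to lim (cvg_cst (4 * r R K.+1 ^+ n))).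
  by exists K => // M /= KM; apply: sec_approx_tail.
(* [A 0] covers the index 0, which the tail bound omits; dividing 4 by [r R K.+1] absorbs the shift
   of the exponent. *)
have r0 := r_gt0 K.+1; exists (A 0%N + 4 / r R K.+1).
  by rewrite addr_ge0 ?normr_ge0 // divr_ge0 // ltW.
case=> [|n]; rewrite -/(A _); first by rewrite expr0 mulr1 lerDl divr_ge0 // ltW.
apply: le_trans (AS n) _.
have -> : (A 0%N + 4 / r R K.+1) * r R K.+1 ^+ n.+1 =
    A 0%N * r R K.+1 ^+ n.+1 + 4 * r R K.+1 ^+ n.
  by rewrite [r R K.+1 ^+ n.+1]exprS; field; rewrite gt_eqF.
by rewrite lerDr mulr_ge0 ?normr_ge0 // exprn_ge0 // ltW.
Qed.

End node_limits.

(** * Tails of the exponential series and convolution with it *)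

Section exponential_tails.
Variable R : realType.

Lemma series_exp_coeff_le (x : R) n : 0 <= x -> series (exp_coeff x) n <= expR x.
Proof.
move=> x0; apply: nondecreasing_cvgn_le; last exact: is_cvg_series_exp_coeff.
by apply: nondecreasing_series => i _ _; rewrite /exp_coeff /= divr_ge0 ?exprn_ge0.
Qed.

(** For [j > n] one has [q^j <= q^n], so [|y|^j <= q^n (|y| / q)^j]; the sum over all [j] is the
    exponential on the right. *)
Lemma expR_tail_le (y q : R) n : 0 < q <= 1 ->
  `|expR y - series (exp_coeff y) n.+1| <= q ^+ n * expR (`|y| / q).
Proof.
case/andP=> q0 q1.
have lim : `|series (exp_coeff y) m - series (exp_coeff y) n.+1| @[m --> \oo]
    --> `|expR y - series (exp_coeff y) n.+1|.
  apply: cvg_norm; apply: cvgB; last exact: cvg_cst.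
  exact: is_cvg_series_exp_coeff.
apply: (ler_cvg_to lim (cvg_cst (q ^+ n * expR (`|y| / q)))).
exists n.+1 => // m /= nm.
rewrite sub_series_geq // (le_trans (ler_norm_sum _ _ _)) //.
have yq0 : 0 <= `|y| / q by rewrite divr_ge0 // ltW.
apply: (@le_trans _ _ (q ^+ n * series (exp_coeff (`|y| / q)) m)); last first.
  by rewrite ler_wpM2l ?exprn_ge0 ?(ltW q0) // series_exp_coeff_le.
rewrite /series /= [X in _ <= _ * X](big_cat_nat (leq0n n.+1) nm) /= mulrDr ler_wpDl //.
  rewrite mulr_ge0 ?exprn_ge0 ?(ltW q0) // sumr_ge0 // => i _.
  by rewrite /exp_coeff /= divr_ge0 ?exprn_ge0.
rewrite mulr_sumr; apply: ler_sum_nat => i /andP[ni _].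
rewrite /exp_coeff /= normrM normrX normfV normr_nat mulrA ler_wpM2r ?invr_ge0 //.
rewrite expr_div_n mulrA ler_pdivlMr ?exprn_gt0 // mulrC ler_wpM2r ?exprn_ge0 //.
by apply: ler_wiXn2l; rewrite ?(ltW q0) // ltnW.
Qed.

(** Every retained index has [|k + 1/3| <= K + 2/3], and [K + 2/3] belongs to the omitted index
    [-(K + 1)]. *)
Lemma r_le_norm_lambda K (k : int) : (`|k| <= K)%N -> r R K.+1 <= `|lambda R k|.
Proof.
move=> kK; have pi0 := pi_gt0 R.
have kK1 : `|k%:~R + 1 / 3| <= K.+1%:R - 1 / 3 :> R.
  have h1 : k%:~R <= K%:R :> R by rewrite -[K%:R]/(K%:~R) ler_int; lia.
  have h2 : - K%:R <= k%:~R :> R by rewrite -[K%:R]/(K%:~R) -rmorphN ler_int; lia.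
  by rewrite ler_norml -[K.+1]addn1 natrD; apply/andP; split; lra.
have k0 : 0 < `|k%:~R + 1 / 3 : R| by rewrite normr_gt0 third_neq0.
rewrite rE // /lambda normrM normfV (ger0_norm (sqrtr_ge0 _)).
rewrite normrM [`|2 * pi|]ger0_norm ?mulr_ge0 ?(ltW pi0) //.
rewrite ler_pM2l ?sqrt3_gt0 // lef_pV2 ?posrE ?mulr_gt0 //; last by lra.
by rewrite ler_pM2l ?mulr_gt0.
Qed.

End exponential_tails.

Lemma sum_absz_leB (R : realType) K (F G : int -> R) :
  sum_absz_le K F - sum_absz_le K G = sum_absz_le K (fun k => F k - G k).
Proof. by rewrite /sum_absz_le sumrB. Qed.

(** Pulling [l k ^+ n.+1] out of the convolution leaves a truncated exponential series at
    [1 / (2 l_k)]. *)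
Lemma conv_exp_sum (R : realType) K n (a l : int -> R) : (forall k, l k != 0) ->
  conv (exp_coeff 2^-1) (fun m => sum_absz_le K (fun k => a k * l k ^+ m.+1)) n =
  sum_absz_le K (fun k => a k * series (exp_coeff (1 / (2 * l k))) n.+1 * l k ^+ n.+1).
Proof.
move=> l0; rewrite /conv /sum_absz_le; under eq_bigr => j _ do rewrite mulr_sumr.
rewrite exchange_big /=; apply: eq_bigr => i _; set k := i%:Z - K%:Z.
rewrite /series /= big_mkord mulr_sumr mulr_suml; apply: eq_bigr => -[j /= jn] _.
rewrite /exp_coeff /= -subSn // -[in RHS](subnK (ltnW jn)) exprD.
rewrite mul1r invfM !exprMn.
transitivity (a k * (2^-1 ^+ j / j`!%:R) * l k ^+ (n.+1 - j) * ((l k)^-1 ^+ j * l k ^+ j)).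
  by rewrite -exprMn mulVf // expr1n; ring.
by ring.
Qed.

Lemma alpha_seq_expansion (R : realType) (K : nat) : exists D : R, forall n,
  `|alpha_seq R n - sum_absz_le K (fun k : int =>
      (-1) ^ k * expR (1 / (2 * lambda R k)) * lambda R k ^+ n.+1)| <= D * r R K.+1 ^+ n.
Proof.
have r0 := r_gt0 R K.+1; set rr := r R K.+1 in r0 *.
have [C C0 secC] := sec_seq_expansion R K.
pose main n : R := sum_absz_le K (fun k => (-1) ^ k * lambda R k ^+ n.+1).
(* [C] accounts for the secant error convolved with the coefficients of [e^(x/2)], and each
   [|lambda k|] for truncating the exponential series of the [k]-th term. *)
exists ((C + sum_absz_le K (fun k => `|lambda R k|)) * expR (1 / (2 * rr))) => n.
rewrite mulrDl [X in _ <= X]mulrDl alpha_seqE.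
have -> : sec_seq R = (fun m => (sec_seq R m - main m) + main m).
  by apply/funext => m; rewrite subrK.
have -> : conv (exp_coeff 2^-1) (fun m => (sec_seq R m - main m) + main m) n =
    conv (exp_coeff 2^-1) (fun m => sec_seq R m - main m) n + conv (exp_coeff 2^-1) main n.
  by rewrite /conv -big_split; apply: eq_bigr => j _; rewrite /= mulrDr.
rewrite -addrA; apply: le_trans (ler_normD _ _) _; apply: lerD.
  apply: le_trans (ler_norm_sum _ _ _) _.
  apply: (@le_trans _ _ (C * rr ^+ n * series (exp_coeff (1 / (2 * rr))) n.+1)).
    rewrite /series /= big_mkord mulr_sumr; apply: ler_sum => -[j /= jn] _.
    have e0 : 0 <= exp_coeff (2^-1 : R) j by rewrite /exp_coeff /= divr_ge0 ?exprn_ge0 ?invr_ge0.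
    rewrite normrM (ger0_norm e0); apply: le_trans (ler_wpM2l e0 (secC _)) _.
    rewrite -/rr /exp_coeff /= -[in X in _ <= X](subnK (_ : (j <= n)%N)) // exprD.
    rewrite mul1r invfM exprMn le_eqVlt; apply/orP; left; apply/eqP.
    transitivity (C * (2^-1 ^+ j / j`!%:R) * rr ^+ (n - j) * (rr^-1 ^+ j * rr ^+ j)).
      by rewrite -exprMn mulVf ?gt_eqF // expr1n; ring.
    by ring.
  rewrite -mulrA [X in _ <= X]mulrAC -[X in _ <= X]mulrA; apply: ler_wpM2l => //.
  apply: ler_wpM2l; first by rewrite exprn_ge0 // ltW.
  by apply: series_exp_coeff_le; rewrite divr_ge0 // mulr_ge0 // ltW.
rewrite conv_exp_sum; last by move=> k; apply: lambda_neq0.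
rewrite sum_absz_leB /sum_absz_le; apply: le_trans (ler_norm_sum _ _ _) _.
rewrite !mulr_suml; apply: ler_sum => i _; set k := i%:Z - K%:Z.
have kK : (`|k| <= K)%N by rewrite /k; case: i @k => i /= ? ; lia.
have l0 : 0 < `|lambda R k| by rewrite normr_gt0 lambda_neq0.
rewrite -mulrBl -mulrBr normrM normrM norm_exprN1z [1 * `|_ - _|]mul1r distrC.
(* With this ratio as [q], the tail bound turns [|lambda k|^n] into [rr^n], and the argument
   [|y| / q] of the exponential becomes [1 / (2 rr)] for every [k]. *)
have q01 : 0 < rr / `|lambda R k| <= 1.
  by rewrite divr_gt0 //= ler_pdivrMr // mul1r r_le_norm_lambda.
apply: le_trans (ler_wpM2r (normr_ge0 _) (expR_tail_le _ n q01)) _.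
have -> : `|1 / (2 * lambda R k)| / (rr / `|lambda R k|) = 1 / (2 * rr).
  rewrite normrM normfV normrM normr1 ger0_norm //.
  by field; rewrite !gt_eqF.
rewrite normrX exprS expr_div_n le_eqVlt; apply/orP; left; apply/eqP.
by field; rewrite expf_neq0 // gt_eqF.
Qed.

Theorem theorem5p4 (R : realType) (K : nat) :
  (fun n : nat => (alpha123 n)%:R / n`!%:R : R)
    = (fun n : nat => sum_absz_le K (fun k : int =>
        (-1) ^ k * expR (1 / (2 * lambda R k)) * lambda R k ^+ n.+1))
      +O_\oo (fun n : nat => r R K.+1 ^+ n).
Proof.
have [D expansion] := alpha_seq_expansion R K.
apply/eqaddOP; exists D; split; first exact: num_real.
move=> D' DD'; exists 0%N => // n _; apply: le_trans (expansion n) _.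
by rewrite normrX (gtr0_norm (r_gt0 R _)) ler_wpM2r ?exprn_ge0 ?ltW ?r_gt0.
Qed.
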